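(* Let $\omega_1,\dots,\omega_{2N}$ be Majorana operators on the Fock space $\mathcal F$ of $N$ fermionic modes, $\{\omega_j,\omega_k\}=2\delta_{jk}$, and let $H_M=\frac{\mathrm i}{4}\sum_{\alpha,\beta=1}^{2N}\omega_\alpha (h_M)_{\alpha\beta}\omega_\beta$ with $h_M$ a real antisymmetric $2N\times 2N$ matrix. Suppose $\{1,\dots,2N\}=A\sqcup B$ with $|A|,|B|$ even, $|A|\ge|B|$, and $(h_M)_{\alpha\beta}=0$ unless one of $\alpha,\beta$ lies in $A$ and the other in $B$. Then there exists an orthonormal basis $\{|E_s\rangle\}_{s\in\{0,1\}^N}$ of $\mathcal F$ consisting of pure Gaussian eigenstates of $H_M$ such that for every $s$ the reduced state of $|E_s\rangle$ on the fermionic modes built from the Majorana operators in $B$ is maximally mixed; equivalently its covariance matrix restricted to $B$ vanishes, $(\Gamma_s)_{jk}=0$ for all $j,k\in B$, and $S(B|E_s)=|B|/2$ (the number of fermionic modes in $B$). In particular every energy eigenstate in this basis is maximally entangled between $A$ and $B$.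
   Context: Majorana operators may be obtained from fermionic modes via $\omega_{2j-1}=f_j^\dagger+f_j$, $\omega_{2j}=-\mathrm i(f_j^\dagger-f_j)$; conversely, pairing up the (even number of) Majorana operators in a set $B$ defines $|B|/2$ fermionic modes, and the algebra they generate is the algebra generated by $\{\omega_j\}_{j\in B}$. Gaussian states are states satisfying Wick's theorem; they are determined by the real antisymmetric covariance matrix $\Gamma_{jk}=\frac{\mathrm i}{2}\operatorname{Tr}(\rho[\omega_j,\omega_k])$. The reduced state on $B$ is the restriction of the state to the algebra generated by $\{\omega_j\}_{j\in B}$, and its covariance matrix is the submatrix $(\Gamma_{jk})_{j,k\in B}$. Entropy $S$ is the von Neumann entropy in units of $\log 2$ (logarithm base 2). *)

(* Defs.v *)
From HB Require Import structures.
From mathcomp Require Import all_boot all_order all_algebra.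
From mathcomp Require Import complex.
From mathcomp Require Import reals exp.

Set Implicit Arguments.
Unset Strict Implicit.
Unset Printing Implicit Defensive.

Import Order.TTheory GRing.Theory Num.Theory.
Local Open Scope ring_scope.
Local Open Scope complex_scope.

Section Fermions.
Variables (R : realType) (N : nat).

(* Operators on the Fock space F of N fermionic modes: 2^N x 2^N complex matrices;
   vectors of F: column vectors. *)
Notation C := R[i].
Notation op := 'M[C]_(2 ^ N).
Notation vec := 'cV[C]_(2 ^ N).
Notation idx := 'I_(2 * N).

Definition adjmx m n (A : 'M[C]_(m, n)) : 'M[C]_(n, m) :=
  \matrix_(i < n, j < m) (A j i)^*.

Definition inner (u v : vec) : C := (adjmx u *m v) 0 0.

Definition expect (psi : vec) (X : op) : C := (adjmx psi *m X *m psi) 0 0.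

Definition omega_prod (w : idx -> op) (s : seq idx) : op :=
  foldr (fun j M => w j *m M) 1%:M s.

Definition majorana (w : idx -> op) : Prop :=
  (forall j, adjmx (w j) = w j) /\
  (forall j k, w j *m w k + w k *m w j = (2 * (j == k)%:R)%:M).

Definition quad_ham (w : idx -> op) (h : 'M[R]_(2 * N)) : op :=
  \sum_(a < 2 * N) \sum_(b < 2 * N) ((('i / 4%:R) * (h a b)%:C) *: (w a *m w b)).

Definition covmx (w : idx -> op) (psi : vec) : 'M[C]_(2 * N) :=
  \matrix_(j, k) ('i / 2%:R * expect psi (w j *m w k - w k *m w j)).

(* Pfaffian of the principal submatrix of G on the index list s, by the
   standard expansion along the first row (n = fuel). *)
Definition rem_nth (T : Type) (l : nat) (t : seq T) := take l t ++ drop l.+1 t.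

Fixpoint pf_aux (n : nat) (G : 'M[C]_(2 * N)) (s : seq idx) : C :=
  match s, n with
  | [::], _ => 1
  | _ :: _, 0 => 0
  | x :: t, n'.+1 =>
      \sum_(l < size t) ((-1) ^+ l * G x (nth x t l) * pf_aux n' G (rem_nth l t))
  end.

Definition pfaff (G : 'M[C]_(2 * N)) (s : seq idx) : C := pf_aux (size s) G s.

(* Wick's theorem for the (pure) state psi: for all j1 < ... < jm,
   <w_{j1} ... w_{jm}> = (-i)^{m/2} Pf(Gamma restricted to {j1..jm})
   (which vanishes for m odd). *)
Definition gaussian (w : idx -> op) (psi : vec) : Prop :=
  forall s : seq idx, sorted (fun a b : idx => (a < b)%N) s ->
    expect psi (omega_prod w s) = (- 'i) ^+ (size s)./2 * pfaff (covmx w psi) s.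

(* the algebra generated by {w_j}_{j in B}: span of ordered monomials *)
Definition in_alg (w : idx -> op) (B : {set idx}) (X : op) : Prop :=
  exists c : {set idx} -> C,
    X = \sum_(S : {set idx} | S \subset B) c S *: omega_prod w (enum S).

(* the reduced state of psi on B is maximally mixed: it is the normalized
   (tracial) state on the algebra generated by {w_j}_{j in B} *)
Definition reduced_maximally_mixed (w : idx -> op) (B : {set idx}) (psi : vec) : Prop :=
  forall X, in_alg w B X -> expect psi X = \tr X / (2 ^ N)%:R.

Definition negxlog2 (x : R) : R := if x == 0 then 0 else - (x * ln x / ln 2).

(* S(B|psi) = s, in units of log 2.  The algebra generated by {w_j}_{j in B}
   is isomorphic to the full matrix algebra on the 2^{|B|/2}-dim Fock space
   of the modes of B, embedded in op as X (x) 1 on a 2^{|A|/2}-dim factor,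
   A the complement of B.  The reduced density matrix rho_B (as element of
   that algebra) is characterized by <X> = Tr(rho_B X) / 2^{|A|/2} for X in
   the algebra; each eigenvalue of rho_B appears 2^{|A|/2} times in the big
   matrix, hence S = (1/2^{|A|/2}) sum over the spectrum of -x log2 x. *)
Definition entropy_B (w : idx -> op) (B : {set idx}) (psi : vec) (s : R) : Prop :=
  exists rho : op,
    in_alg w B rho /\
    (forall X, in_alg w B X ->
       expect psi X = \tr (rho *m X) / (2 ^ (#|~: B| %/ 2))%:R) /\
    exists (U : op) (d : 'rV[R]_(2 ^ N)),
      U *m adjmx U = 1%:M /\
      rho = U *m diag_mx (map_mx (fun x : R => x%:C) d) *m adjmx U /\
      s = (\sum_(i < 2 ^ N) negxlog2 (d 0 i)) / (2 ^ (#|~: B| %/ 2))%:R.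

End Fermions.

(* Main.v *)
Require Import Defs.
From HB Require Import structures.
From mathcomp Require Import all_boot all_order all_algebra.
From mathcomp Require Import spectral complex.
From mathcomp Require boolp.
From mathcomp Require Import reals exp.
From mathcomp Require Import ring lra zify.
Import Order.TTheory GRing.Theory Num.Theory.
Local Open Scope ring_scope.
Local Open Scope complex_scope.

Set Implicit Arguments.
Unset Strict Implicit.
Unset Printing Implicit Defensive.

(* The off-diagonal block of h has a real singular value decomposition, i.e.
   there are orthonormal real vectors u_m (supported on A) and v_m, m < N, with
   h = sum_m e_m (u_m v_m^T - v_m u_m^T); the |A| - |B| left singular vectors
   without partner are paired among themselves with e_m = 0.  With
   U_m = sum_x u_m(x) w_x and V_m = sum_x v_m(x) w_x, the Hamiltonian becomes
   sum_m (e_m / 2) T_m, where the T_m = i U_m V_m are commuting Hermitian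
   involutions.  A joint eigenvector with signs t_m exists for every choice of
   signs, since U_m flips t_m and preserves the others.  On it each w_x acts as
   i sum_y J_xy w_y with J = sum_m t_m (u_m v_m^T - v_m u_m^T), so
   w_x - i sum_y J_xy w_y annihilates it; commuting this operator through a
   monomial gives the first-row expansion of the Pfaffian, which is Wick's
   theorem with covariance J.  As every u_m vanishes on B, so does the B-B block
   of J, and all nonempty monomials in B have expectation 0, as in the tracial
   state. *)

(** * Real singular value decomposition *)

Lemma dotmx_ge0 (R : realDomainType) n (x : 'rV[R]_n) : 0 <= (x *m x^T) 0 0.
Proof. by rewrite mxE sumr_ge0 // => i _; rewrite mxE -expr2 sqr_ge0. Qed.

Lemma dotmx_eq0 (R : realDomainType) n (x : 'rV[R]_n) :
  (x *m x^T) 0 0 = 0 -> x = 0.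
Proof.
move=> x0; apply/rowP => i; rewrite mxE; apply/eqP; rewrite -sqrf_eq0 expr2.
move: x0; rewrite mxE => /psumr_eq0P => /(_ _ i isT).
by rewrite mxE => -> // j _; rewrite mxE -expr2 sqr_ge0.
Qed.

Lemma normalize_row (R : rcfType) n (x : 'rV[R]_n) : x != 0 ->
  exists2 c, c != 0 & (c *: x) *m (c *: x)^T = 1%:M.
Proof.
move=> x0; set q := (x *m x^T) 0 0.
have q0 : q > 0.
  by rewrite lt_def dotmx_ge0 andbT; apply: contraNneq x0 => /dotmx_eq0 ->.
exists (Num.sqrt q)^-1; first by rewrite invr_eq0 sqrtr_eq0 -ltNge.
rewrite linearZ /= -scalemxAl -scalemxAr scalerA [x *m _]mx11_scalar -/q.
rewrite scale_scalar_mx -expr2 exprVn sqr_sqrtr ?ltW // mulVf //.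
by rewrite gt_eqF.
Qed.

(** A complex eigenvector [z] for the eigenvalue a + ib exists because R[i] is algebraically closed.
    Its real and imaginary parts [x], [y] satisfy coupled equations which symmetry of [S] decouples;
    whichever part is nonzero is a real eigenvector for a. *)
Lemma symmetric_eigenvector (R : rcfType) n (S : 'M[R]_n.+1) : S^T = S ->
  exists a (v : 'rV_n.+1), v != 0 /\ v *m S = a *: v.
Proof.
move=> symS.
have [[a b] /eigenvalueP [z zS z0]] :=
  eigenvalue_closed (map_mx (real_complex R) S) (ltn0Sn n).
pose x := map_mx (@complex.Re R) z; pose y := map_mx (@complex.Im R) z.
have xS : x *m S = a *: x - b *: y.
  apply/rowP => j; move/rowP/(_ j)/(congr1 (@complex.Re R)): zS; rewrite !mxE.
  rewrite (raddf_sum (@complex.Re R : Rcomplex R -> R)) => zS.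
  transitivity (complex.Re ((a +i* b) * z 0 j)); last by case: (z 0 j).
  rewrite -zS; apply: eq_bigr => k _; rewrite !mxE.
  by case: (z 0 k) => p q /=; rewrite mulr0 subr0.
have yS : y *m S = b *: x + a *: y.
  apply/rowP => j; move/rowP/(_ j)/(congr1 (@complex.Im R)): zS; rewrite !mxE.
  rewrite (raddf_sum (@complex.Im R : Rcomplex R -> R)) => zS.
  transitivity (complex.Im ((a +i* b) * z 0 j)).
    rewrite -zS; apply: eq_bigr => k _; rewrite !mxE.
    by case: (z 0 k) => p q /=; rewrite mulr0 add0r.
  by case: (z 0 j) => p q /=; rewrite addrC.
(* Compare [x S y^T] with its transpose [y S x^T]. *)
have b0 : b * ((x *m x^T) 0 0 + (y *m y^T) 0 0) = 0.
  have xSy : (x *m S *m y^T) 0 0 = (y *m S *m x^T) 0 0.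
    rewrite -[LHS](mxE trmx_key (fun i j => (x *m S *m y^T) j i)) -/(trmx _).
    by rewrite !trmx_mul trmxK symS mulmxA.
  have xy : (x *m y^T) 0 0 = (y *m x^T) 0 0.
    rewrite -[LHS](mxE trmx_key (fun i j => (x *m y^T) j i)) -/(trmx _).
    by rewrite !trmx_mul trmxK.
  move: xSy; rewrite xS yS mulmxBl mulmxDl -!scalemxAl.
  move: (x *m x^T) (y *m y^T) xy => X Y; rewrite !mxE => -> E; lra.
have [x0|x0] := eqVneq x 0; last first.
  exists a, x; split=> //; rewrite xS; apply/eqP.
  rewrite addrC -subr_eq0 addrK oppr_eq0.
  move/eqP: b0; rewrite mulf_eq0 => /orP[/eqP->|]; first by rewrite scale0r.
  rewrite paddr_eq0 ?dotmx_ge0 // => /andP[/eqP/dotmx_eq0 E].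
  by rewrite E eqxx in x0.
exists a, y; split; last by rewrite yS x0 scaler0 add0r.
apply: contra_neq z0 => y0; apply/rowP => j.
move/rowP/(_ j): x0; move/rowP/(_ j): y0; rewrite !mxE.
by case: (z 0 j) => p q /= -> ->.
Qed.

(** Take [v] to be a unit eigenvector of [M^T *m M] and [u] the normalization of [v *m M^T]. This
    fails only when [v *m M^T] vanishes, and then [u] has to come from the left kernel of [M]. *)
Lemma singular_pair (R : rcfType) m n (M : 'M[R]_(m.+1, n.+1)) : (n <= m)%N ->
  exists s (u : 'rV_m.+1) (v : 'rV_n.+1),
    [/\ u *m u^T = 1%:M, v *m v^T = 1%:M, u *m M = s *: v & v *m M^T = s *: u].
Proof.
move=> le_nm.
have symS : (M^T *m M)^T = M^T *m M by rewrite trmx_mul trmxK.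
have [a [v0 [v0_neq0 v0S]]] := symmetric_eigenvector symS.
have [c c0 vv] := normalize_row v0_neq0.
set v := c *: v0 in vv.
have vS : v *m M^T *m M = a *: v.
  by rewrite -mulmxA /v -scalemxAl v0S !scalerA mulrC.
have v_neq0 : v != 0 by rewrite scaler_eq0 negb_or c0.
(* For the singular value 0, [n <= m] yields a vector [u] with [u M = 0]. *)
have [u0|u0] := eqVneq (v *m M^T) 0.
  have rk : (\rank M < m.+1)%N.
    apply: leq_trans (_ : n < m.+1)%N => //.
    rewrite ltn_neqAle -{2}mxrank_tr rank_leq_row andbT.
    apply: contra_neqN v_neq0 => /eqP rk.
    have /row_freeP[D MD] : row_free M^T by rewrite /row_free mxrank_tr rk.
    by rewrite -[v]mulmx1 -MD mulmxA u0 mul0mx.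
  have u_neq0 : nz_row (kermx M) != 0.
    by rewrite nz_row_eq0 -mxrank_eq0 mxrank_ker subn_eq0 -ltnNge.
  have [d d0 uu] := normalize_row u_neq0.
  exists 0, (d *: nz_row (kermx M)), v; split=> //.
    rewrite scale0r -scalemxAl; apply/eqP; rewrite scaler_eq0.
    by rewrite (sub_kermxP (nz_row_sub _)) eqxx orbT.
  by rewrite scale0r.
have [d d0 uu] := normalize_row u0.
(* The squared norm of [v *m M^T] is the eigenvalue [a]. Hence [d^-1] is a square root of [a] and
   serves as the singular value; its sign is immaterial. *)
have da : d * d * a = 1.
  move: uu; rewrite linearZ /= trmx_mul trmxK -scalemxAl -scalemxAr scalerA.
  rewrite mulmxA vS -scalemxAl vv scalerA => /matrixP/(_ 0 0).
  by rewrite !mxE mulr1.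
exists (d^-1), (d *: (v *m M^T)), v; split=> //.
  rewrite -scalemxAl vS scalerA; congr (_ *: _).
  by apply: (mulfI d0); rewrite mulfV // mulrA.
by rewrite scalerA mulVf // scale1r.
Qed.

Lemma reflection_to (R : realFieldType) n (v : 'rV[R]_n.+1) : v *m v^T = 1%:M ->
  exists Q, [/\ Q^T = Q, Q *m Q = 1%:M & row 0 Q = v].
Proof.
move=> vv; pose e : 'rV[R]_n.+1 := delta_mx 0 0.
(* The Householder reflection exchanging [v] and the first basis vector. *)
have [->|ve] := eqVneq v e.
  by exists 1%:M; split; rewrite ?trmx1 ?mulmx1 // row1.
have [x xE] : {x | x = v - e} by exists (v - e).
pose q := (x *m x^T) 0 0.
have xx : x *m x^T = q%:M by rewrite [LHS]mx11_scalar.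
have q0 : q != 0.
  by apply: contra_neq ve => /dotmx_eq0/eqP; rewrite xE subr_eq0 => /eqP.
(* Both [v] and [e] are unit vectors, so |v - e|^2 = 2 - 2 v_0. This is what makes the reflected [e]
   equal to [e + x = v]. *)
have qE : q = - 2 * x 0 0.
  rewrite /q xE linearB /= mulmxBl !mulmxBr vv.
  rewrite /e trmx_delta mul_delta_mx -rowE -colE !mxE !eqxx; lra.
exists (1%:M - (2 / q) *: (x^T *m x)); split.
- by rewrite linearB linearZ /= trmx1 trmx_mul trmxK.
- rewrite mulmxBl mul1mx mulmxBr mulmx1 -scalemxAl -scalemxAr scalerA.
  rewrite -mulmxA (mulmxA x) xx mul_scalar_mx -scalemxAr scalerA.
  move: (x^T *m x) => Y; apply/matrixP => i j; rewrite !mxE; field.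
  by rewrite q0.
- rewrite rowE mulmxBr mulmx1 -scalemxAr mulmxA -rowE.
  have -> : row 0 x^T = (x 0 0)%:M by rewrite [LHS]mx11_scalar !mxE.
  have q2 : 2 / q * x 0 0 = -1.
    rewrite qE; field; apply: contra_neq q0 => E.
    by rewrite qE E mulr0.
  by rewrite mul_scalar_mx scalerA q2 scaleN1r opprK xE addrC subrK.
Qed.

(** Reflections carrying a singular pair to the first basis vectors clear the first row and column
    outside the corner entry; induction treats the lower right block. The block lemmas get explicit
    dimensions so that [m.+1] is read as [1 + m]. *)
Lemma singular_value_decomposition (R : rcfType) m n (M : 'M[R]_(m, n)) :
  (n <= m)%N -> exists (P : 'M_m) (Q : 'M_n),
    [/\ P *m P^T = 1%:M, Q *m Q^T = 1%:M &
      forall (i : 'I_m) (j : 'I_n), i != j :> nat -> (P *m M *m Q^T) i j = 0].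
Proof.
elim: n m M => [|n IHn] [|m] M // le_nm.
- by exists 1%:M, 1%:M; split=> [||? []//]; rewrite trmx1 mulmx1.
- by exists 1%:M, 1%:M; split=> [||? []//]; rewrite trmx1 mulmx1.
have [s [u [v [uu vv uM vM]]]] := singular_pair M le_nm.
have [P0 [symP PP rP]] := reflection_to uu.
have [Q0 [symQ QQ rQ]] := reflection_to vv.
have [M0 M0def] : {M0 | M0 = P0 *m M *m Q0} by eexists.
have row0 : row 0 M0 = s *: delta_mx 0 0.
  rewrite M0def !row_mul rP uM -scalemxAl; congr (_ *: _).
  by rewrite -rQ -row_mul QQ row1.
have col0 : col 0 M0 = s *: delta_mx 0 0.
  apply: trmx_inj; rewrite tr_col M0def !trmx_mul symP symQ mulmxA !row_mul rQ vM.
  rewrite -scalemxAl -rP -row_mul PP row1 linearZ /=; congr (_ *: _).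
  by rewrite trmx_delta.
have row0E j : M0 0 j = s *+ (j == 0).
  by move/rowP/(_ j): row0; rewrite !mxE eqxx mulr_natr.
have col0E i : M0 i 0 = s *+ (i == 0).
  by move/colP/(_ i): col0; rewrite !mxE eqxx andbT mulr_natr.
have [P1 [Q1 [PP1 QQ1 diag1]]] := IHn m (@drsubmx _ 1 m 1 n M0) le_nm.
have M0E : M0 = @block_mx _ 1 m 1 n s%:M 0 0 (@drsubmx _ 1 m 1 n M0).
  rewrite -[LHS](@submxK _ 1 m 1 n); congr (@block_mx _ 1 m 1 n _ _ _ _).
  - apply/matrixP => i j; rewrite !ord1 !mxE -[RHS]/(s *+ (0 == 0 :> 'I_n.+1)).
    by rewrite -row0E; congr (@fun_of_matrix _ m.+1 n.+1 M0 _ _); apply: val_inj.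
  - apply/rowP => j; rewrite !mxE.
    rewrite -[RHS]/(s *+ (rshift 1 j == 0 :> 'I_n.+1)) -row0E.
    by congr (@fun_of_matrix _ m.+1 n.+1 M0 _ _); apply: val_inj.
  - apply/colP => i; rewrite !mxE.
    rewrite -[RHS]/(s *+ (rshift 1 i == 0 :> 'I_m.+1)) -col0E.
    by congr (@fun_of_matrix _ m.+1 n.+1 M0 _ _); apply: val_inj.
exists ((@block_mx _ 1 m 1 m 1%:M 0 0 P1) *m P0).
exists ((@block_mx _ 1 n 1 n 1%:M 0 0 Q1) *m Q0).
have bl k (X : 'M[R]_k) : X *m X^T = 1%:M ->
   (@block_mx _ 1 k 1 k 1%:M 0 0 X) *m (@block_mx _ 1 k 1 k 1%:M 0 0 X)^T = 1%:M.
  move=> XX; rewrite tr_block_mx mulmx_block !trmx0 !trmx1.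
  by rewrite !mulmx0 !mul0mx !mulmx1 XX !addr0 add0r -scalar_mx_block.
have block_mul3 (X : 'M[R]_m) (Y : 'M[R]_(m, n)) (Z : 'M[R]_n) :
    (@block_mx _ 1 m 1 m 1%:M 0 0 X) *m (@block_mx _ 1 m 1 n s%:M 0 0 Y) *m
      (@block_mx _ 1 n 1 n 1%:M 0 0 Z)^T =
    @block_mx _ 1 m 1 n s%:M 0 0 (X *m Y *m Z^T).
  rewrite tr_block_mx !mulmx_block !trmx0 !trmx1.
  by rewrite !mulmx0 !mul0mx !mulmx1 !mul1mx !addr0 !add0r ?mulmx0 ?mul0mx.
split.
- by rewrite trmx_mul symP mulmxA -[_ *m P0 *m P0]mulmxA PP mulmx1 bl.
- by rewrite trmx_mul symQ mulmxA -[_ *m Q0 *m Q0]mulmxA QQ mulmx1 bl.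
move=> i j; rewrite trmx_mul symQ mulmxA.
rewrite -[X in X *m Q0]mulmxA -[X in X *m _^T]mulmxA.
rewrite -M0def M0E block_mul3.
rewrite -(@splitK 1 m i) -(@splitK 1 n j).
case: (split _) => i'; case: (split _) => j' /=.
- by rewrite !ord1.
- by rewrite (@block_mxEur _ 1 m 1 n) mxE.
- by rewrite (@block_mxEdl _ 1 m 1 n) mxE.
- rewrite (@block_mxEdr _ 1 m 1 n) => ij; apply: diag1.
  by apply: contra ij => /eqP ->.
Qed.

(** * Paired normal form of the Hamiltonian matrix *)

(* Row [i] of [P], extended by zero outside [S]; zero if [i] is out of range. *)
Definition ext_row (R : nzRingType) (T : finType) (S : {set T}) (P : 'M[R]_#|S|)
    (i : nat) (x : T) : R :=
  \sum_(i' < #|S| | i' == i :> nat) \sum_(k < #|S|) P i' k *+ (enum_val k == x).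

Section ExtRow.
Variables (R : nzRingType) (T : finType) (S : {set T}) (P : 'M[R]_#|S|).

Lemma ext_row_out i x : x \notin S -> ext_row P i x = 0.
Proof.
move=> xS; rewrite /ext_row big1 // => i' _; rewrite big1 // => k _.
by case: eqP => // kx; rewrite -kx enum_valP in xS.
Qed.

Lemma ext_row_val (i k : 'I_#|S|) : ext_row P i (enum_val k) = P i k.
Proof.
rewrite /ext_row (big_pred1 i) // (bigD1 k) //= eqxx big1 ?addr0 // => l lk.
by rewrite (inj_eq enum_val_inj) (negPf lk).
Qed.

Lemma ext_row_dot i j : P *m P^T = 1%:M -> (i < #|S|)%N -> (j < #|S|)%N ->
  \sum_x ext_row P i x * ext_row P j x = (i == j)%:R.
Proof.
move=> PP iS jS; rewrite (bigID (mem S)) /= addrC big1 ?add0r; last first.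
  by move=> x xS; rewrite ext_row_out // mul0r.
rewrite big_enum_val /=; move/matrixP/(_ (Ordinal iS) (Ordinal jS)): PP.
rewrite !mxE /= => <-; apply: eq_bigr => k _.
by rewrite (ext_row_val (Ordinal iS)) (ext_row_val (Ordinal jS)) !mxE.
Qed.

End ExtRow.

(** All [u m] are taken from the larger side, also for the modes with coefficient 0, so that they
    all vanish on [B]. Parity of [#|B|] lets the unmatched left singular vectors be paired off. *)
Lemma paired_normal_form (R : rcfType) N (h : 'M[R]_(2 * N)) (B : {set 'I_(2 * N)}) :
  h^T = - h -> ~~ odd #|B| -> (#|B| <= #|~: B|)%N ->
  (forall a b, (a \in B) = (b \in B) -> h a b = 0) ->
  exists (u v : 'I_N -> 'I_(2 * N) -> R) (sg : 'I_N -> R),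
  [/\ forall m m', \sum_x u m x * u m' x = (m == m')%:R,
      forall m m', \sum_x v m x * v m' x = (m == m')%:R,
      forall m m', \sum_x u m x * v m' x = 0,
      forall m x, x \in B -> u m x = 0 &
      forall a b, h a b = \sum_m sg m * (u m a * v m b - v m a * u m b)].
Proof.
move=> skewh evB le_BC hAB.
have [A defA] : {A | A = ~: B} by exists (~: B).
have inA x : (x \in A) = (x \notin B) by rewrite defA inE.
have cAB : (#|B| + #|A| = 2 * N)%N by rewrite defA cardsC card_ord.
have le_BA : (#|B| <= #|A|)%N by rewrite defA.
pose M : 'M[R]_(#|A|, #|B|) := \matrix_(i, j) h (enum_val i) (enum_val j).
have [P [Q [PP QQ diag]]] := singular_value_decomposition M le_BA.
set D := P *m M *m Q^T in diag.
have ME : M = P^T *m D *m Q.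
  rewrite /D !mulmxA (mulmx1C PP) mul1mx -mulmxA (mulmx1C QQ) mulmx1 //.
(* Modes [m < #|B|] carry the singular pairs; mode [m >= #|B|] pairs the
   unmatched rows [2 m - #|B|] and [2 m - #|B| + 1] of [P]. *)
pose s0 (m : nat) := \sum_(j < #|B| | j == m :> nat) D (widen_ord le_BA j) j.
pose fu (m : nat) := if (m < #|B|)%N then m else (2 * m - #|B|)%N.
pose u (m : 'I_N) := ext_row P (fu m).
pose v (m : 'I_N) := if (m < #|B|)%N then ext_row Q m
                     else ext_row P (2 * m - #|B|).+1.
have fuA m : (m < N -> fu m < #|A|)%N.
  by rewrite /fu; case: ifP; lia.
have bN : (#|B| <= N)%N by lia.
have vA m : (m < N -> ~~ (m < #|B|) -> (2 * m - #|B|).+1 < #|A|)%N by lia.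
have vinj (m m' : nat) : ~~ (m < #|B|)%N -> ~~ (m' < #|B|)%N ->
  ((2 * m - #|B|).+1 == (2 * m' - #|B|).+1) = (m == m') by lia.
(* For [m < #|B|] the right side exceeds [#|B|]; otherwise the two row numbers differ in parity. *)
have uv_neq m m' : ~~ (m' < #|B|)%N -> fu m == (2 * m' - #|B|).+1 = false.
  by rewrite /fu; case: ifP; lia.
have AB0 i j x : ext_row P i x * ext_row Q j x = 0.
  have [xB|xB] := boolP (x \in B); last by rewrite (ext_row_out Q) ?mulr0.
  by rewrite ext_row_out ?mul0r // inA negbK.
exists u, v, (fun m => s0 m); split.
- move=> m m'; rewrite /u ext_row_dot ?fuA //; congr (_ : bool)%:R.
  rewrite -val_eqE /=; move: (ltn_ord m) (ltn_ord m') => mN m'N.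
  rewrite /fu.
  by case: ifP; case: ifP; lia.
- move=> m m'; rewrite /v; move: (ltn_ord m) (ltn_ord m') => mN m'N.
  case: ifPn => mB; case: ifPn => m'B.
  + by rewrite ext_row_dot.
  + rewrite (_ : m == m' = false); last by rewrite -val_eqE /=; lia.
    by rewrite big1 // => x _; rewrite mulrC AB0.
  + rewrite (_ : m == m' = false); last by rewrite -val_eqE /=; lia.
    by rewrite big1 // => x _; rewrite AB0.
  + rewrite ext_row_dot ?vA //.
    congr (_ : bool)%:R; rewrite -val_eqE /=.
    exact: vinj.
- move=> m m'; rewrite /u /v; move: (ltn_ord m) (ltn_ord m') => mN m'N.
  case: ifPn => m'B; first by rewrite big1.
  rewrite ext_row_dot ?fuA ?vA //.
  by rewrite uv_neq.
- by move=> m x xB; rewrite /u ext_row_out // inA negbK.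
(* The sum defining [s0] runs over column indices equal to [m]; it is empty, hence 0, for the
   unmatched modes. *)
have s0_out m : (#|B| <= m)%N -> s0 m = 0.
  by move=> mB; rewrite /s0 big_pred0 // => j; have := ltn_ord j; lia.
(* On A x B only the first product survives, and the formula is an entry of the decomposition of
   [M]. On the same-side blocks both sides vanish, and B x A follows by antisymmetry. *)
have hAB0 a b : a \in A -> b \in B ->
    h a b = \sum_(m < N) s0 m * (u m a * v m b - v m a * u m b).
  move=> aA bB.
  transitivity (\sum_(j < #|B|) s0 j * (ext_row P j a * ext_row Q j b)).
    pose k := enum_rank_in aA a; pose l := enum_rank_in bB b.
    have ka : enum_val k = a by rewrite enum_rankK_in.
    have lb : enum_val l = b by rewrite enum_rankK_in.
    have /matrixP/(_ k l) := ME; rewrite !mxE ka lb => ->.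
    apply: eq_bigr => j _; rewrite mxE (bigD1 (widen_ord le_BA j)) //=.
    rewrite big1 ?addr0; last first.
      move=> i ij; rewrite diag ?mulr0 //.
    rewrite mxE -lb -ka ext_row_val (ext_row_val P (widen_ord le_BA j)).
    by rewrite /s0 (big_pred1 j) //; ring.
  rewrite (big_ord_widen _ (fun j => s0 j * (ext_row P j a * ext_row Q j b)) bN).
  rewrite big_mkcond; apply: eq_bigr => m _; case: ifPn => mB.
    by rewrite /u /v /fu mB (@ext_row_out _ _ _ Q m a) ?mul0r ?subr0 // -inA.
  by rewrite s0_out ?mul0r // leqNgt.
have same a b : (a \in B) = (b \in B) ->
    \sum_(m < N) s0 m * (u m a * v m b - v m a * u m b) = 0.
  move=> ab; rewrite big1 // => m _; rewrite /u /v.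
  case: ifPn => mB; last by rewrite s0_out ?mul0r // leqNgt.
  have [aB|aB] := boolP (a \in B).
    by rewrite !(ext_row_out P) ?inA -?ab ?aB ?(mul0r, mulr0, subr0).
  by rewrite !(ext_row_out Q) -?ab ?aB ?(mul0r, mulr0, subr0).
move=> a b; have [|nab] := eqVneq (a \in B) (b \in B).
  by move=> ab; rewrite same // hAB.
have hba : h a b = - h b a by have /matrixP/(_ b a) := skewh; rewrite !mxE.
have [aB|aB] := boolP (a \in B).
  rewrite hba hAB0 ?inA //; last by move: nab; rewrite aB; case: (b \in B).
  by rewrite -sumrN; apply: eq_bigr => m _; ring.
by rewrite hAB0 ?inA //; move: nab; rewrite (negPf aB); case: (b \in B).
Qed.

(** The 2N vectors are the rows of a square matrix, whose one-sided inverse is two-sided. *)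
Lemma orthonormal_complete (R : comNzRingType) N (u v : 'I_N -> 'I_(2 * N) -> R) :
  (forall m m', \sum_x u m x * u m' x = (m == m')%:R) ->
  (forall m m', \sum_x v m x * v m' x = (m == m')%:R) ->
  (forall m m', \sum_x u m x * v m' x = 0) ->
  forall x y, \sum_m (u m x * u m y + v m x * v m y) = (x == y)%:R.
Proof.
move=> uu vv uv x y.
pose F : 'M[R]_(N + N, 2 * N) :=
  col_mx (\matrix_(m, x) u m x) (\matrix_(m, x) v m x).
(* [N + N] and [2 * N] are equal but not convertible, so squareness is supplied as an equation. *)
have mulC m n (X : 'M[R]_(m, n)) : m = n -> X *m X^T = 1%:M -> X^T *m X = 1%:M.
  by move=> mn; case: _ / mn X => X; apply: mulmx1C.
have FF : F *m F^T = 1%:M.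
  rewrite tr_col_mx mul_col_row scalar_mx_block; congr block_mx;
    apply/matrixP => m m'; rewrite !mxE.
  - by rewrite -uu; apply: eq_bigr => z _; rewrite !mxE.
  - by rewrite -[RHS](uv m m'); apply: eq_bigr => z _; rewrite !mxE.
  - by rewrite -[RHS](uv m' m); apply: eq_bigr => z _; rewrite !mxE mulrC.
  - by rewrite -vv; apply: eq_bigr => z _; rewrite !mxE.
have /matrixP/(_ x y) := mulC _ _ F (esym (etrans (mul2n N) (esym (addnn N)))) FF.
rewrite tr_col_mx mul_row_col !mxE => <-; rewrite big_split /=.
by congr (_ + _); apply: eq_bigr => m _; rewrite !mxE.
Qed.

(** * Adjoints and expectation values *)

Section Adjoint.
Variable R : realType.
Local Notation C := R[i].

Lemma adjmxK m n (X : 'M[C]_(m, n)) : adjmx (adjmx X) = X.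
Proof. by apply/matrixP => i j; rewrite !mxE conjcK. Qed.

Lemma adjmx1 n : adjmx (1%:M : 'M[C]_n) = 1%:M.
Proof. by apply/matrixP => i j; rewrite !mxE rmorph_nat eq_sym. Qed.

Lemma adjmxD m n (X Y : 'M[C]_(m, n)) : adjmx (X + Y) = adjmx X + adjmx Y.
Proof. by apply/matrixP => i j; rewrite !mxE rmorphD. Qed.

Lemma adjmxZ m n c (X : 'M[C]_(m, n)) : adjmx (c *: X) = conjc c *: adjmx X.
Proof. by apply/matrixP => i j; rewrite !mxE rmorphM. Qed.

Lemma adjmx_sum m n I (r : seq I) (F : I -> 'M[C]_(m, n)) :
  adjmx (\sum_(i <- r) F i) = \sum_(i <- r) adjmx (F i).
Proof.
apply: (big_morph _ (@adjmxD m n)).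
by apply/matrixP => i j; rewrite !mxE rmorph0.
Qed.

Lemma adjmxM m n p (X : 'M[C]_(m, n)) (Y : 'M[C]_(n, p)) :
  adjmx (X *m Y) = adjmx Y *m adjmx X.
Proof.
apply/matrixP => i j; rewrite !mxE rmorph_sum; apply: eq_bigr => k _.
by rewrite !mxE rmorphM mulrC.
Qed.

Lemma sqr_imaginary : 'i * 'i = -1 :> C.
Proof. by rewrite -expr2 sqr_i. Qed.

Lemma conj_imaginary : conjc ('i : C) = - 'i.
Proof. by rewrite /= -[RHS]/(- 0 +i* - 1) oppr0. Qed.

Lemma inner_gt0 N (psi : 'cV[C]_(2 ^ N)) : psi != 0 -> 0 < inner psi psi.
Proof.
move=> psi0; have ge0 i : 0 <= adjmx psi 0 i * psi i 0.
  by rewrite mxE mulrC mulcJ_ge0.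
rewrite /inner mxE lt_def sumr_ge0 // andbT.
apply: contra_neq psi0 => /psumr_eq0P E; apply/colP => i; rewrite mxE.
have /eqP := E (fun i _ => ge0 i) i isT.
by rewrite mxE mulf_eq0 conjc_eq0 orbb => /eqP.
Qed.

Lemma normalize_vector N (psi : 'cV[C]_(2 ^ N)) : psi != 0 ->
  exists c : C, inner (c *: psi) (c *: psi) = 1.
Proof.
move=> /inner_gt0 psi0; set q := inner psi psi in psi0 *.
have [r rE conj_r] : exists2 r : C, r = (sqrtC q)^-1 & conjc r = r.
  exists (sqrtC q)^-1 => //.
  by apply: (@conj_Creal C); rewrite realV ger0_real // sqrtC_ge0 ltW.
exists r; rewrite /inner adjmxZ -scalemxAl -scalemxAr scalerA mxE conj_r.
by rewrite -expr2 rE exprVn sqrtCK mulVf // gt_eqF.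
Qed.

Section Expect.
Variables (N : nat) (psi : 'cV[C]_(2 ^ N)).
Local Notation op := 'M[C]_(2 ^ N).

Lemma expectD (X Y : op) : expect psi (X + Y) = expect psi X + expect psi Y.
Proof. by rewrite /expect mulmxDr mulmxDl mxE. Qed.

Lemma expectZ c (X : op) : expect psi (c *: X) = c * expect psi X.
Proof. by rewrite /expect -scalemxAr -scalemxAl mxE. Qed.

Lemma expectB (X Y : op) : expect psi (X - Y) = expect psi X - expect psi Y.
Proof. by rewrite expectD -scaleN1r expectZ mulN1r. Qed.

Lemma expect_sum I (r : seq I) (P : pred I) (F : I -> op) :
  expect psi (\sum_(i <- r | P i) F i) = \sum_(i <- r | P i) expect psi (F i).
Proof.
apply: (big_morph _ expectD).
by rewrite /expect mulmx0 mul0mx mxE.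
Qed.

Lemma expect1 : expect psi 1%:M = inner psi psi.
Proof. by rewrite /expect mulmx1. Qed.

Lemma expect_ker (X Y : op) : Y *m psi = 0 -> expect psi (X *m Y) = 0.
Proof. by move=> Y0; rewrite /expect mulmxA -mulmxA Y0 mulmx0 mxE. Qed.

Lemma expect_coker (X Y : op) :
  adjmx Y *m psi = 0 -> expect psi (Y *m X) = 0.
Proof.
move=> Y0; rewrite /expect mulmxA.
have -> : adjmx psi *m Y = 0.
  rewrite -[LHS]adjmxK adjmxM adjmxK Y0.
  by apply/matrixP => i j; rewrite !mxE rmorph0.
by rewrite !mul0mx mxE.
Qed.

End Expect.
End Adjoint.

(** * Majorana operators and Wick's theorem *)

Section Majorana.
Variables (R : realType) (N : nat).
Local Notation C := R[i].
Local Notation op := 'M[C]_(2 ^ N).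
Local Notation idx := 'I_(2 * N).
Variable w : idx -> op.
Hypothesis w_adj : forall j, adjmx (w j) = w j.
Hypothesis w_car :
  forall j k, w j *m w k + w k *m w j = (2 * (j == k)%:R)%:M.

Definition smear (x : idx -> R) : op := \sum_j (x j)%:C *: w j.

Lemma smear_adj x : adjmx (smear x) = smear x.
Proof.
rewrite adjmx_sum; apply: eq_bigr => j _.
by rewrite adjmxZ w_adj conjc_real.
Qed.

Lemma smearM x y :
  smear x *m smear y = \sum_j \sum_k (x j * y k)%:C *: (w j *m w k).
Proof.
rewrite mulmx_suml; apply: eq_bigr => j _; rewrite mulmx_sumr.
by apply: eq_bigr => k _; rewrite -scalemxAl -scalemxAr scalerA -rmorphM.
Qed.

(** After exchanging the sums in the second product, the terms off the diagonal cancel. By this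
    Clifford relation, orthonormal real vectors give Majorana operators again. *)
Lemma smear_car x y :
  smear x *m smear y + smear y *m smear x = (2 * (\sum_j x j * y j)%:C)%:M.
Proof.
rewrite !smearM [X in _ + X]exchange_big -big_split /=.
rewrite rmorph_sum mulr_sumr raddf_sum /=; apply: eq_bigr => j _.
rewrite -big_split /= (bigD1 j) //= big1 ?addr0 => [|k kj].
  by rewrite [y j * _]mulrC -scalerDr w_car eqxx mulr1 scale_scalar_mx mulrC.
rewrite [y k * _]mulrC -scalerDr w_car eq_sym (negPf kj) mulr0.
by rewrite scale_scalar_mx mulr0 raddf0.
Qed.

Lemma omega_sqr j : w j *m w j = 1%:M.
Proof.
have := w_car j j; rewrite eqxx mulr1 -mulr2n -scaler_nat => E.
apply: (@scalerI _ _ (2%:R : C)); first by rewrite pnatr_eq0.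
by rewrite E scale_scalar_mx mulr1.
Qed.

Lemma omega_anticomm j k : j != k -> w j *m w k = - (w k *m w j).
Proof.
move=> /negPf jk; apply/eqP; rewrite -subr_eq0 opprK w_car jk mulr0.
by rewrite raddf0.
Qed.

Lemma omega_prod_anticomm j s : j \notin s ->
  w j *m omega_prod w s = (-1) ^+ size s *: (omega_prod w s *m w j).
Proof.
elim: s => [|x s IHs] /=; first by rewrite mulmx1 mul1mx scale1r.
rewrite inE negb_or => /andP[jx js].
rewrite mulmxA omega_anticomm // mulNmx -(mulmxA _ (w j)) IHs // -scalemxAr.
by rewrite exprS mulN1r scaleNr mulmxA.
Qed.

Lemma trace_omega_prod s : uniq s -> s != [::] -> \tr (omega_prod w s) = 0.
Proof.
have neg_eq0 (z : C) : z = - z -> z = 0.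
  move=> /eqP; rewrite -subr_eq0 opprK -mulr2n -mulr_natr mulf_eq0.
  by rewrite pnatr_eq0 orbF => /eqP.
case: s => // x t /[dup] us /andP[xt ut] _.
(* An even monomial anticommutes with its first factor, an odd one with any
   Majorana operator not occurring in it. *)
case: (boolP (odd (size t))) => t_odd; apply: neg_eq0.
  rewrite -[omega_prod _ _]/(w x *m omega_prod w t).
  rewrite {1}omega_prod_anticomm // -signr_odd t_odd /= expr1 scaleN1r.
  by rewrite raddfN /= mxtrace_mulC.
(* A monomial of odd length cannot exhaust the 2N indices. *)
have [j js] : exists j, j \notin x :: t.
  apply/existsP; rewrite -negb_forall; apply: contra t_odd => /forallP all_in.
  have : size (x :: t) = #|idx|.
    by rewrite -(card_uniqP us); apply: eq_card => y; rewrite all_in.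
  by rewrite card_ord /= => E; have : odd (size t).+1 = false;
    [rewrite E mul2n odd_double | move=> /= /negbFE].
rewrite -{1}[omega_prod _ _]mul1mx -(omega_sqr j) -mulmxA.
rewrite omega_prod_anticomm // -signr_odd /= t_odd expr1 scaleN1r mulmxN.
by rewrite raddfN /= mulmxA mxtrace_mulC mulmxA omega_sqr mul1mx.
Qed.

Section Wick.
Variables (psi : 'cV[C]_(2 ^ N)) (J : idx -> idx -> R).
Hypothesis psi1 : inner psi psi = 1.
Hypothesis J_skew : forall x y, J x y = - J y x.
Hypothesis J_psi : forall x, w x *m psi = 'i *: (smear (J x) *m psi).

Let ann x : op := w x - 'i *: smear (J x).

Lemma ann_psi x : ann x *m psi = 0.
Proof. by rewrite mulmxBl J_psi -scalemxAl subrr. Qed.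

Let smear_delta x : smear (fun j => (j == x)%:R) = w x.
Proof.
rewrite /smear (bigD1 x) //= eqxx scale1r big1 ?addr0 // => j /negPf ->.
by rewrite rmorph0 scale0r.
Qed.

Lemma ann_car x y :
  ann x *m w y + w y *m ann x = (2 * ((x == y)%:R - 'i * (J x y)%:C))%:M.
Proof.
rewrite mulmxBl mulmxBr -scalemxAl -scalemxAr addrACA w_car -opprD -scalerDr.
rewrite -[w y]smear_delta smear_car (bigD1 y) //= eqxx mulr1 big1 ?addr0.
  by rewrite scale_scalar_mx -raddfB /= mulrBr mulrCA.
by move=> j /negPf ->; rewrite mulr0.
Qed.

(** [w x] is half the sum of [ann x] and its adjoint, and the adjoint vanishes when acting to the
    left on the bra of [psi]. *)
Lemma expect_ann x X : expect psi (w x *m X) = expect psi (ann x *m X) / 2.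
Proof.
have adj0 : expect psi ((w x + 'i *: smear (J x)) *m X) = 0.
  apply: expect_coker; rewrite adjmxD adjmxZ w_adj smear_adj conj_imaginary.
  by rewrite scaleNr ann_psi.
have sumE : expect psi (ann x *m X) +
    expect psi ((w x + 'i *: smear (J x)) *m X) = 2 * expect psi (w x *m X).
  rewrite -expectD -mulmxDl addrACA addNr addr0 -mulr2n -scaler_nat.
  by rewrite -scalemxAl expectZ.
by rewrite -[expect psi (ann x *m X)]addr0 -{}adj0 sumE mulrC mulKf ?pnatr_eq0.
Qed.

Lemma expect_omega2 x y :
  expect psi (w x *m w y) = (x == y)%:R - 'i * (J x y)%:C.
Proof.
rewrite expect_ann -[ann x *m w y](addrK (w y *m ann x)) ann_car.
rewrite expectB expect_ker ?ann_psi // subr0 -scalemx1 expectZ.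
by rewrite expect1 psi1 mulr1 mulrC mulKf ?pnatr_eq0.
Qed.

Lemma covmx_J x y : covmx w psi x y = (J x y)%:C.
Proof.
rewrite mxE expectB !expect_omega2 (J_skew y x) eq_sym rmorphN.
transitivity (- ('i * 'i) * (J x y)%:C); last by rewrite sqr_imaginary opprK mul1r.
by field.
Qed.

(** Each anticommutation leaves a scalar, twice the two-point function, and a sign. The last term
    has [ann x] on the far right, where it kills [psi]. *)
Lemma ann_omega_prod x s :
  ann x *m omega_prod w s =
    \sum_(l < size s) ((-1) ^+ l * (2 * expect psi (w x *m w (nth x s l)))) *:
      omega_prod w (rem_nth l s) + (-1) ^+ size s *: (omega_prod w s *m ann x).
Proof.
elim: s => [|y t IHt]; first by rewrite big_ord0 add0r scale1r mulmx1 mul1mx.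
rewrite big_ord_recl /= expr0 mul1r /rem_nth /= drop0 -/(omega_prod w t).
rewrite mulmxA -[ann x *m w y](addrK (w y *m ann x)) ann_car -expect_omega2.
rewrite mulmxBl mul_scalar_mx -(mulmxA (w y) (ann x)) IHt mulmxDr opprD addrA.
congr (_ + _ + _).
  rewrite mulmx_sumr -sumrN; apply: eq_bigr => l _.
  by rewrite -scalemxAr -scaleNr exprS mulN1r mulNr.
by rewrite -scalemxAr mulmxA -scaleNr exprS mulN1r.
Qed.

Lemma expect_omega_prod_cons x t :
  expect psi (omega_prod w (x :: t)) =
    \sum_(l < size t) (-1) ^+ l * expect psi (w x *m w (nth x t l)) *
      expect psi (omega_prod w (rem_nth l t)).
Proof.
rewrite /= expect_ann ann_omega_prod expectD expectZ expect_ker ?ann_psi //.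
rewrite mulr0 addr0 expect_sum mulr_suml; apply: eq_bigr => l _.
rewrite expectZ mulrCA !mulrA mulrC !mulrA mulVf ?pnatr_eq0 //.
by rewrite mul1r.
Qed.

Lemma size_rem_nth (T : Type) l (s : seq T) : (l < size s)%N ->
  size (rem_nth l s) = (size s).-1.
Proof. by move=> ls; rewrite size_cat size_take size_drop ls; lia. Qed.

Lemma subseq_rem_nth (T : eqType) l (s : seq T) : subseq (rem_nth l s) s.
Proof.
rewrite -[X in subseq _ X](cat_take_drop l); apply: cat_subseq => //.
by rewrite -add1n -drop_drop drop_subseq.
Qed.

Lemma gaussian_J : gaussian w psi.
Proof.
(* [n] is the fuel of [pf_aux]. *)
suff wick n s : uniq s -> (size s <= n)%N ->
    expect psi (omega_prod w s) =
      (- 'i) ^+ (size s)./2 * pf_aux n (covmx w psi) s.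
  move=> s s_sorted; apply: wick => //; apply: sorted_uniq s_sorted.
    by move=> y x z; apply: ltn_trans.
  by move=> x; rewrite /= ltnn.
elim: n s => [|n IHn] [|x t] //.
- by move=> _ _; rewrite /= expect1 psi1 mulr1.
- by move=> _ _; rewrite /= expect1 psi1 mulr1.
have pf_cons : pf_aux n.+1 (covmx w psi) (x :: t) = \sum_(l < size t)
    (-1) ^+ l * covmx w psi x (nth x t l) * pf_aux n (covmx w psi) (rem_nth l t).
  by [].
move=> /andP[xt ut] tn; rewrite expect_omega_prod_cons pf_cons mulr_sumr.
apply: eq_bigr => l _.
have lt := ltn_ord l.
have xl : x == nth x t l = false.
  by apply: contraNF xt => /eqP ->; rewrite mem_nth.
rewrite expect_omega2 xl sub0r.
rewrite IHn ?(subseq_uniq (subseq_rem_nth _ _)) //; last first.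
  by rewrite size_rem_nth //; move: tn lt; rewrite /=; lia.
rewrite size_rem_nth // covmx_J -mulNr.
(* As [l < size t], the tail is nonempty, so a contraction lowers the half-length by exactly one. It
   contributes one factor -i, since distinct indices have two-point function -i J. *)
have -> : (size (x :: t))./2 = ((size t).-1)./2.+1 by move: lt => /=; lia.
rewrite exprS; ring.
Qed.

Lemma expect_omega_prod0 (S : {set idx}) s :
  {in S &, forall x y, J x y = 0} -> uniq s -> {subset s <= S} ->
  s != [::] -> expect psi (omega_prod w s) = 0.
Proof.
move=> J0; case: s => // x t /andP[xt ut] sS _; rewrite expect_omega_prod_cons.
apply: big1 => l _; rewrite expect_omega2 J0 ?sS ?mem_head //; last first.
  by rewrite inE mem_nth ?orbT.
rewrite rmorph0 mulr0 subr0 (_ : _ == _ = false) ?mulr0 ?mul0r //.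
by apply: contraNF xt => /eqP ->; rewrite mem_nth.
Qed.

(** By linearity only monomials matter: the state and the normalized trace both give 1 on the
    identity and 0 on every other monomial. *)
Lemma reduced_maximally_mixed_J (S : {set idx}) :
  {in S &, forall x y, J x y = 0} -> reduced_maximally_mixed w S psi.
Proof.
move=> J0 _ [c ->]; rewrite expect_sum raddf_sum /= mulr_suml.
apply: eq_bigr => T TS; rewrite expectZ mxtraceZ -mulrA; congr (_ * _).
have [->|T0] := eqVneq T set0.
  rewrite enum_set0 /= expect1 psi1 mxtrace1 mulfV //.
  by rewrite pnatr_eq0 -lt0n expn_gt0.
have s0 : enum T != [::] by rewrite -size_eq0 -cardE cards_eq0.
rewrite trace_omega_prod ?enum_uniq // mul0r.
apply: (expect_omega_prod0 J0) => //; first exact: enum_uniq.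
by move=> x; rewrite mem_enum => /(subsetP TS).
Qed.

End Wick.
End Majorana.

(** * Joint eigenvectors of the mode parities *)

Section Modes.
Variables (R : realType) (N : nat).
Local Notation C := R[i].
Local Notation op := 'M[C]_(2 ^ N).
Local Notation idx := 'I_(2 * N).
Variable w : idx -> op.
Hypothesis w_adj : forall j, adjmx (w j) = w j.
Hypothesis w_car :
  forall j k, w j *m w k + w k *m w j = (2 * (j == k)%:R)%:M.
Variables u v : 'I_N -> idx -> R.
Hypothesis uu : forall m m', \sum_x u m x * u m' x = (m == m')%:R.
Hypothesis vv : forall m m', \sum_x v m x * v m' x = (m == m')%:R.
Hypothesis uv : forall m m', \sum_x u m x * v m' x = 0.

Let U m : op := smear w (u m).
Let V m : op := smear w (v m).

(** Up to sign this is 1 - 2n, with n the occupation number of the fermionic mode built from [U m]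
    and [V m]. *)
Definition mode_parity m : op := 'i *: (U m *m V m).
Local Notation T := mode_parity.

Let smear_sqr x : \sum_j x j * x j = 1 -> smear w x *m smear w x = 1%:M.
Proof.
move=> x1; have := smear_car w_car x x; rewrite x1 -mulr2n -scaler_nat => E.
apply: (@scalerI _ _ (2%:R : C)); first by rewrite pnatr_eq0.
by rewrite E scale_scalar_mx.
Qed.

Let smear_anticomm x y :
  \sum_j x j * y j = 0 -> smear w x *m smear w y = - (smear w y *m smear w x).
Proof.
move=> xy; apply/eqP; rewrite -subr_eq0 opprK smear_car // xy rmorph0 mulr0.
by rewrite raddf0.
Qed.

Let U_sqr m : U m *m U m = 1%:M.
Proof. by apply: smear_sqr; rewrite uu eqxx. Qed.

Let V_sqr m : V m *m V m = 1%:M.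
Proof. by apply: smear_sqr; rewrite vv eqxx. Qed.

Let UV m m' : U m *m V m' = - (V m' *m U m).
Proof. by apply: smear_anticomm; rewrite uv. Qed.

Let UU m m' : m != m' -> U m *m U m' = - (U m' *m U m).
Proof. by move=> /negPf mm'; apply: smear_anticomm; rewrite uu mm'. Qed.

Let VV m m' : m != m' -> V m *m V m' = - (V m' *m V m).
Proof. by move=> /negPf mm'; apply: smear_anticomm; rewrite vv mm'. Qed.

Lemma mode_parity_adj m : adjmx (T m) = T m.
Proof.
rewrite adjmxZ adjmxM !smear_adj // conj_imaginary /T UV.
by rewrite scalerN scaleNr.
Qed.

Lemma mode_parity_sqr m : T m *m T m = 1%:M.
Proof.
rewrite /T -scalemxAl -scalemxAr scalerA sqr_imaginary scaleN1r.
rewrite mulmxA -(mulmxA (U m)) -[V m *m U m]opprK -UV mulmxN mulNmx opprK.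
by rewrite mulmxA U_sqr mul1mx V_sqr.
Qed.

Let anticomm2_comm (X Y Z : op) : X *m Y = - (Y *m X) -> X *m Z = - (Z *m X) ->
  X *m (Y *m Z) = Y *m Z *m X.
Proof.
move=> XY XZ.
by rewrite mulmxA XY mulNmx -(mulmxA Y X) XZ mulmxN opprK mulmxA.
Qed.

Let U_parity m m' : m != m' -> U m *m T m' = T m' *m U m.
Proof.
move=> mm'; rewrite -scalemxAr -scalemxAl anticomm2_comm //.
exact: UU.
Qed.

Let V_parity m m' : m != m' -> V m *m T m' = T m' *m V m.
Proof.
move=> mm'; rewrite -scalemxAr -scalemxAl anticomm2_comm ?UV ?opprK //.
exact: VV.
Qed.

Let parity_U m : T m *m U m = - (U m *m T m).
Proof.
rewrite -scalemxAr -scalemxAl -mulmxA -[V m *m U m]opprK -UV.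
by rewrite mulmxN scalerN.
Qed.

Lemma mode_parity_comm m m' : m != m' -> T m *m T m' = T m' *m T m.
Proof.
move=> mm'; rewrite {1}/T -scalemxAl -mulmxA V_parity // mulmxA U_parity //.
by rewrite -mulmxA scalemxAr.
Qed.

(** The signs are imposed one mode at a time, starting from an arbitrary nonzero vector. Every
    operator applied at mode [m0] commutes with the other parities, so the eigenvalues already fixed
    survive. *)
Lemma joint_eigenvector (t : 'I_N -> C) : (forall m, t m * t m = 1) ->
  exists2 psi : 'cV[C]_(2 ^ N), psi != 0 & forall m, T m *m psi = t m *: psi.
Proof.
move=> tt; suff partial k : (k <= N)%N -> exists2 psi : 'cV[C]_(2 ^ N),
    psi != 0 & forall m : 'I_N, (m < k)%N -> T m *m psi = t m *: psi.
  have [psi psi0 Tpsi] := partial N (leqnn N).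
  by exists psi => // m; apply: Tpsi.
elim: k => [|k IHk] kN.
  exists (const_mx 1) => //; apply/eqP => /colP.
  move=> /(_ (Ordinal (expn_gt0 2 N : (0 < 2 ^ N)%N))).
  by rewrite !mxE => /eqP; rewrite oner_eq0.
have [psi psi0 Tpsi] := IHk (ltnW kN).
pose m0 := Ordinal kN.
have lt_neq (m : 'I_N) : (m < k.+1)%N -> m != m0 -> (m < k)%N.
  by rewrite -val_eqE /= ltnS ltn_neqAle => -> ->.
(* Project onto the eigenspace of [T m0]; if [psi] has the opposite parity, flip
   it with [U m0]. *)
have [psi'0|psi'0] := eqVneq (psi + t m0 *: (T m0 *m psi)) 0; last first.
  exists (psi + t m0 *: (T m0 *m psi)) => // m mk.
  have [->|mm0] := eqVneq m m0.
    rewrite mulmxDr -scalemxAr mulmxA mode_parity_sqr mul1mx scalerDr scalerA.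
    by rewrite tt scale1r addrC.
  rewrite mulmxDr -scalemxAr mulmxA mode_parity_comm // -mulmxA.
  by rewrite Tpsi ?lt_neq // -scalemxAr scalerDr !scalerA mulrC.
exists (U m0 *m psi).
  apply: contra_neq psi0 => Upsi.
  by rewrite -[psi]mul1mx -(U_sqr m0) -mulmxA Upsi mulmx0.
move=> m mk; have [->|mm0] := eqVneq m m0.
  rewrite mulmxA parity_U mulNmx -mulmxA scalemxAr -mulmxN; congr (_ *m _).
  have : t m0 *: (psi + t m0 *: (T m0 *m psi)) = 0 by rewrite psi'0 scaler0.
  by rewrite scalerDr scalerA tt scale1r => /eqP; rewrite addr_eq0 => /eqP ->.
by rewrite mulmxA -U_parity 1?eq_sym // -mulmxA Tpsi ?lt_neq // scalemxAr.
Qed.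

Lemma joint_eigenvector_ortho (psi phi : 'cV[C]_(2 ^ N)) (r t : C) m :
  T m *m psi = r *: psi -> T m *m phi = t *: phi -> conjc r = r -> r != t ->
  inner psi phi = 0.
Proof.
move=> Tpsi Tphi rr rt; apply/eqP; move: rt; rewrite -subr_eq0.
have : r * inner psi phi = t * inner psi phi.
  transitivity ((adjmx psi *m T m *m phi) 0 0); last first.
    by rewrite -mulmxA Tphi -scalemxAr mxE.
  rewrite -(mode_parity_adj m) -adjmxM Tpsi adjmxZ rr -scalemxAl mxE //.
move=> /eqP; rewrite -subr_eq0 -mulrBl mulf_eq0 => /orP[->|] //.
Qed.

Lemma smear_lin2 (a b : 'I_N -> R) :
  smear w (fun y => \sum_m (a m * u m y + b m * v m y)) =
    \sum_m ((a m)%:C *: U m + (b m)%:C *: V m).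
Proof.
rewrite /smear; under eq_bigr => j _ do rewrite rmorph_sum scaler_suml.
rewrite exchange_big; apply: eq_bigr => m _.
rewrite !scaler_sumr -big_split; apply: eq_bigr => j _ /=.
by rewrite rmorphD !rmorphM scalerDl !scalerA.
Qed.

Hypothesis uv_complete :
  forall x y, \sum_m (u m x * u m y + v m x * v m y) = (x == y)%:R.

Lemma omega_modes x : w x = \sum_m ((u m x)%:C *: U m + (v m x)%:C *: V m).
Proof.
rewrite -smear_lin2 /smear (bigD1 x) //= uv_complete eqxx scale1r big1 ?addr0 //.
by move=> j /negPf jx; rewrite uv_complete eq_sym jx rmorph0 scale0r.
Qed.

(** This is the paired normal form with signs [t m] as coefficients; it becomes the covariance
    matrix of the joint eigenvector. *)
Definition mode_cov (t : 'I_N -> R) x y :=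
  \sum_m t m * (u m x * v m y - v m x * u m y).

Lemma mode_cov_skew t x y : mode_cov t x y = - mode_cov t y x.
Proof. by rewrite /mode_cov -sumrN; apply: eq_bigr => m _; ring. Qed.

(** The eigenvalue equation for [T m] turns [U m] on [psi] into i t_m [V m], and [V m] into -i t_m
    [U m]; these are substituted into the mode expansion of [w x]. *)
Lemma omega_eigenvector t (psi : 'cV[C]_(2 ^ N)) x : (forall m, t m * t m = 1) ->
  (forall m, T m *m psi = (t m)%:C *: psi) ->
  w x *m psi = 'i *: (smear w (mode_cov t x) *m psi).
Proof.
move=> tt Tpsi.
have Upsi m : U m *m psi = ('i * (t m)%:C) *: (V m *m psi).
  rewrite -scalerA scalemxAr -Tpsi mulmxA scalemxAl /T -scalemxAr scalerA.
  rewrite sqr_imaginary scaleN1r mulmxA -[V m *m U m]opprK -UV.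
  by rewrite !mulNmx opprK -(mulmxA (U m)) V_sqr mulmx1.
have Vpsi m : V m *m psi = - ('i * (t m)%:C) *: (U m *m psi).
  rewrite Upsi scalerA mulNr mulrACA sqr_imaginary -rmorphM tt mulN1r opprK.
  by rewrite scale1r.
rewrite omega_modes mulmx_suml.
have -> : mode_cov t x =
    fun y => \sum_m (- (t m * v m x) * u m y + t m * u m x * v m y).
  by apply: boolp.funext => y; apply: eq_bigr => m _; ring.
rewrite smear_lin2 mulmx_suml scaler_sumr; apply: eq_bigr => m _.
rewrite !mulmxDl -!scalemxAl {1}Vpsi {1}Upsi scalerDr !scalerA addrC.
by congr (_ *: _ + _ *: _); rewrite ?rmorphN !rmorphM /=; ring.
Qed.

(** Each mode contributes (i/4) e_m (U_m V_m - V_m U_m), and anticommutation makes the bracket 2 U_m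
    V_m. *)
Lemma quad_ham_modes (h : 'M[R]_(2 * N)) (e : 'I_N -> R) :
  (forall a b, h a b = \sum_m e m * (u m a * v m b - v m a * u m b)) ->
  quad_ham w h = \sum_m (e m / 2)%:C *: T m.
Proof.
move=> hE.
have -> : quad_ham w h = ('i / 4%:R) *: \sum_a \sum_b (h a b)%:C *: (w a *m w b).
  rewrite scaler_sumr; apply: eq_bigr => a _; rewrite scaler_sumr.
  by apply: eq_bigr => b _; rewrite scalerA.
have -> : \sum_a \sum_b (h a b)%:C *: (w a *m w b) =
    \sum_m (e m)%:C *: (U m *m V m - V m *m U m).
  transitivity (\sum_m \sum_a \sum_b
      (e m * (u m a * v m b - v m a * u m b))%:C *: (w a *m w b)).
    rewrite [RHS]exchange_big; apply: eq_bigr => a _ /=.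
    rewrite [RHS]exchange_big; apply: eq_bigr => b _ /=.
    by rewrite hE rmorph_sum scaler_suml.
  apply: eq_bigr => m _; rewrite !smearM -sumrB scaler_sumr.
  apply: eq_bigr => a _; rewrite -sumrB scaler_sumr; apply: eq_bigr => b _.
  by rewrite -scalerBl scalerA -rmorphB -rmorphM.
rewrite scaler_sumr; apply: eq_bigr => m _.
have -> : U m *m V m - V m *m U m = (2%:R : C) *: (U m *m V m).
  by rewrite -[V m *m U m]opprK -UV opprK scaler_nat mulr2n.
rewrite !scalerA.
congr (_ *: _); by rewrite rmorphM fmorphV rmorph_nat; field.
Qed.

End Modes.

(** * Entropy of the maximally mixed reduced state *)

Lemma negxlog2_half_pow (R : realType) b :
  negxlog2 ((2 ^+ b)^-1 : R) = b%:R / 2 ^+ b.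
Proof.
rewrite /negxlog2 invr_eq0 expf_eq0 pnatr_eq0 andbF.
rewrite lnV ?posrE ?exprn_gt0 // lnXn // -mulr_natr.
by field; rewrite mul1r expf_eq0 pnatr_eq0 andbF gt_eqF ?ln_gt0 ?ltr1n.
Qed.

(** The reduced density matrix is the scalar 2^-b, a multiple of the empty monomial. Each of its 2^N
    = 2^a 2^b eigenvalues contributes b 2^-b, and division by the multiplicity 2^a leaves b. *)
Lemma maximally_mixed_entropy (R : realType) N (w : 'I_(2 * N) -> 'M[R[i]]_(2 ^ N))
    (B : {set 'I_(2 * N)}) (psi : 'cV[R[i]]_(2 ^ N)) :
  ~~ odd #|B| -> reduced_maximally_mixed w B psi ->
  entropy_B w B psi (#|B| %/ 2)%:R.
Proof.
move=> evB mixed; set b := (#|B| %/ 2)%N; set a := (#|~: B| %/ 2)%N.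
have abN : (a + b = N)%N.
  have := cardsC B; rewrite card_ord /a /b => cB.
  move: evB cB; move: #|B| #|~: B| => p q; lia.
pose x : R := (2 ^+ b)^-1.
have x2 : x%:C / 2 ^+ a = (2 ^ N)%:R^-1 :> R[i].
  by rewrite natrX -abN exprD /x fmorphV rmorphXn rmorph_nat -invfM mulrC.
exists (x%:C)%:M; split; last split.
- exists (fun S => if S == set0 then x%:C else 0).
  rewrite (bigD1 set0) ?sub0set //= eqxx enum_set0 big1 ?addr0 ?scalemx1 //.
  by move=> S /andP[_ /negPf ->]; rewrite scale0r.
- move=> X /mixed ->; rewrite mul_scalar_mx mxtraceZ -x2 natrX.
  by rewrite mulrCA mulrA.
exists 1%:M, (const_mx x); split; first by rewrite adjmx1 mulmx1.
split.
  by rewrite adjmx1 mulmx1 mul1mx map_const_mx diag_const_mx.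
under eq_bigr => i _ do rewrite mxE negxlog2_half_pow.
have pN : (2 ^ N)%:R = 2 ^+ a * 2 ^+ b :> R by rewrite -exprD abN natrX.
rewrite sumr_const card_ord -(mulr_natr _ (2 ^ N)) pN natrX.
by field; rewrite ?mul1r !expf_eq0 pnatr_eq0 !andbF.
Qed.

(** * Assembling the eigenbasis *)

Theorem theorem1 (R : realType) (N : nat)
  (w : 'I_(2 * N) -> 'M[R[i]]_(2 ^ N)) (h : 'M[R]_(2 * N)) (B : {set 'I_(2 * N)}) :
  majorana w ->
  h^T = - h ->
  ~~ odd #|B| -> ~~ odd #|~: B| -> (#|B| <= #|~: B|)%N ->
  (forall a b : 'I_(2 * N), ~~ (((a \in B) && (b \notin B)) || ((a \notin B) && (b \in B))) ->
     h a b = 0) ->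
  exists E : {ffun 'I_N -> bool} -> 'cV[R[i]]_(2 ^ N),
    (forall s t, inner (E s) (E t) = (s == t)%:R) /\
    forall s,
      (exists lam : R[i], quad_ham w h *m E s = lam *: E s) /\
      gaussian w (E s) /\
      reduced_maximally_mixed w B (E s) /\
      (forall j k, j \in B -> k \in B -> covmx w (E s) j k = 0) /\
      entropy_B w B (E s) (#|B| %/ 2)%:R.
Proof.
move=> [w_adj w_car] h_skew evB _ le_BA h_bip.
have [a b ab|u [v [e [uu vv uv u_B hE]]]] := paired_normal_form h_skew evB le_BA.
  by apply: h_bip; rewrite ab; case: (b \in B).
have uv1 := orthonormal_complete uu vv uv.
pose sgn (s : {ffun 'I_N -> bool}) m : R := (-1) ^+ s m.
have sgn2 s m : sgn s m * sgn s m = 1 by rewrite -expr2 sqrr_sign.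
(* Choice turns existence for each sign pattern into a function of the bit string. *)
have eigen s : {psi : 'cV[R[i]]_(2 ^ N) | inner psi psi = 1 /\
    forall m, mode_parity w u v m *m psi = (sgn s m)%:C *: psi}.
  apply: boolp.cid.
  have [|psi psi0 Tpsi] :=
      joint_eigenvector w_car uu vv uv (t := fun m => (sgn s m)%:C).
    by move=> m; rewrite -rmorphM sgn2.
  have [c c1] := normalize_vector psi0; exists (c *: psi); split=> // m.
  by rewrite -scalemxAr Tpsi !scalerA mulrC.
exists (fun s => sval (eigen s)); split=> [s t|s].
  have [<-|st] := eqVneq s t; first by case: (eigen s) => psi [].
  case: (eigen s) (eigen t) => psi [_ Tpsi] [phi [_ Tphi]] /=.
  (* Distinct bit strings differ at some mode, where the two vectors have opposite parities. *)
  have [m stm] : exists m, s m != t m.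
    apply/existsP; rewrite -negb_forall; apply: contra st => /forallP st.
    by apply/eqP/ffunP => m; apply/eqP.
  apply: (joint_eigenvector_ortho w_adj w_car uv (Tpsi m) (Tphi m)).
    exact: conjc_real.
  by rewrite (inj_eq (@complexI R)); apply: contra_neq stm => /signr_inj.
case: (eigen s) => psi [psi1 Tpsi] /=.
have J_psi x := omega_eigenvector w_car vv uv uv1 x (sgn2 s) Tpsi.
have J_B : {in B &, forall x y, mode_cov u v (sgn s) x y = 0}.
  move=> x y xB yB; rewrite /mode_cov big1 // => m _.
  by rewrite !u_B // mul0r mulr0 subrr mulr0.
have J_skew := mode_cov_skew u v (sgn s).
have mixed := reduced_maximally_mixed_J w_adj w_car psi1 J_psi J_B.
split; last split; last split=> //; last split.
(* The energy is the sum of the terms e_m / 2, each with the sign of its mode. *)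
- exists (\sum_m (e m / 2)%:C * (sgn s m)%:C).
  rewrite (quad_ham_modes w_car uv hE) mulmx_suml scaler_suml.
  by apply: eq_bigr => m _; rewrite -scalemxAl Tpsi scalerA.
- exact: (gaussian_J w_adj w_car psi1 J_skew J_psi).
- by move=> j k jB kB; rewrite (covmx_J w_adj w_car psi1 J_skew J_psi) J_B.
- exact: maximally_mixed_entropy.
Qed.
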